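(* Let $(Y,S)$ be a topological dynamical system that is minimal, weak mixing, not connected (i.e. $Y$ is not connected), and such that every subcontinuum of $Y$ is unicoherent. Let $n>0$ be an integer, and let $(X,T)$ be an extension of $(Y,S)$ with factor map $\pi:X\to Y$ such that $\#\pi^{-1}(y)=n$ for every $y\in Y$. Finally, let $M\subseteq X$ be a minimal set of $T$. Then $(M,T|_M)$ is $LYS$.
   Context: A topological dynamical system $(X,T)$ is a compact metric space $(X,\rho)$ with a continuous surjective map $T:X\to X$. It is transitive if for all nonempty open $U,V\subset X$ there is a positive integer $n$ with $U\cap T^{-n}(V)\ne\emptyset$; weak mixing if $(X\times X,T\times T)$ is transitive; minimal if every point has a dense orbit $\{T^n(x)\}_{n\ge0}$. A minimal set is a nonempty closed invariant set $M$ such that $(M,T|_M)$ is minimal. $(Y,S)$ is a factor of $(X,T)$, and $(X,T)$ an extension of $(Y,S)$, if there is a continuous surjection (factor map) $\pi:X\to Y$ with $\pi\circ T=S\circ\pi$. A continuum is a nonempty connected compact metric space. A continuum $K$ is unicoherent if for every two continua $A,B$ with $A\cup B=K$ the set $A\cap B$ is connected. $(X,T)$ is Li-Yorke sensitive, $LYS$, if there is $\varepsilon>0$ such that every $x\in X$ is a limit of points $y\in X$ with $\liminf_{n\to\infty}\rho(T^n(x),T^n(y))=0$ and $\limsup_{n\to\infty}\rho(T^n(x),T^n(y))>\varepsilon$; the same definition is used for $(M,T|_M)$. *)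

(* Defs.v *)
From HB Require Import structures.
From mathcomp Require Import all_boot all_order all_algebra.
From mathcomp Require Import all_classical all_reals all_analysis.

Set Implicit Arguments.
Unset Strict Implicit.
Unset Printing Implicit Defensive.

Import Order.TTheory GRing.Theory Num.Theory.
Import numFieldNormedType.Exports.

Local Open Scope classical_set_scope.
Local Open Scope ring_scope.

(* MathComp-Analysis gives a subset, seen as a type, the initial topology and
   the induced pseudometric; with the induced distance it is a metric space. *)
Section subset_metric.
Context {R : realType} {X : metricType R} (A : set X).

Let sdist (x y : A) : R := mdist (val x) (val y).

Let sdist_ge0 x y : 0 <= sdist x y.
Proof. exact: mdist_ge0. Qed.

Let sdist_positivity x y : sdist x y = 0 -> x = y.
Proof. by move=> /mdist_positivity /val_inj. Qed.

Let ballEsdist (x : A) d : ball x d = [set y | sdist x y < d].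
Proof. by rewrite -initial_ballE ballEmdist. Qed.

HB.instance Definition _ := PseudoMetric_isMetric.Build R (set_type A)
  sdist_ge0 sdist_positivity ballEsdist.

End subset_metric.

Definition forward_orbit (X : topologicalType) (T : X -> X) (x : X) : set X :=
  [set iter k T x | k in [set: nat]].

Definition transitive_map (X : topologicalType) (T : X -> X) :=
  forall U V : set X, open U -> open V -> U !=set0 -> V !=set0 ->
    exists k : nat, (0 < k)%N /\ U `&` (iter k T @^-1` V) !=set0.

Definition minimal_map (X : topologicalType) (T : X -> X) :=
  forall x : X, dense (forward_orbit T x).

Definition restrict_map (X : topologicalType) (T : X -> X) (M : set X)
    (TM : set_fun M M T) : M -> M :=
  sigLR (mkfun_fun TM).

(* Invariance is the inclusion of T(M) in M. Equality, i.e. surjectivity of the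
   restriction, follows from minimality when X is compact Hausdorff and T is
   continuous. *)
Record minimal_set (X : topologicalType) (T : X -> X) (M : set X) : Prop :=
    MinimalSet {
  minimal_set_nonempty : M !=set0 ;
  minimal_set_closed : closed M ;
  minimal_set_fun : set_fun M M T ;
  minimal_set_minimal : minimal_map (restrict_map minimal_set_fun)
}.

Definition weak_mixing (X : topologicalType) (T : X -> X) :=
  transitive_map (fun p : X * X => (T p.1, T p.2)).

Section metric_dynamics.
Context {R : realType}.

Definition tds (X : metricType R) (T : X -> X) :=
  [/\ compact [set: X], continuous T & range T = [set: X]].

Definition factor_map (X Y : metricType R) (T : X -> X) (S : Y -> Y)
    (p : X -> Y) :=
  [/\ continuous p, range p = [set: Y] & p \o T = S \o p].

Definition continuum (X : metricType R) (K : set X) :=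
  [/\ K !=set0, connected K & compact K].

Definition unicoherent (X : metricType R) (K : set X) :=
  forall A B : set X, continuum A -> continuum B -> A `|` B = K ->
    connected (A `&` B).

(* The liminf and limsup are taken in the extended reals, where they exist
   without any boundedness assumption. *)
Definition li_yorke_eps (X : metricType R) (T : X -> X) (eps : R) (x y : X) :=
  let d := fun k : nat => (mdist (iter k T x) (iter k T y))%:E in
  limn_einf d = 0%E /\ (eps%:E < limn_esup d)%E.

Definition LYS (X : metricType R) (T : X -> X) :=
  exists2 eps : R, 0 < eps &
    forall x : X, closure [set y | li_yorke_eps T eps x y] x.

End metric_dynamics.

(* Main.v *)
Require Import Defs.
From HB Require Import structures.
From mathcomp Require Import all_boot all_order all_algebra.
From mathcomp Require Import all_classical all_reals all_analysis.
From mathcomp Require Import lra.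

Set Implicit Arguments.
Unset Strict Implicit.
Unset Printing Implicit Defensive.

Import Order.TTheory GRing.Theory Num.Theory.
Import numFieldNormedType.Exports.

Local Open Scope classical_set_scope.
Local Open Scope ring_scope.

(** The minimal set [M] with the restriction of [T] is a minimal system over
    [(Y, S)] whose fibres are finite of bounded size. It need not be weakly
    mixing, since it may also have a finite rotation as a factor; but this is
    the only obstruction, and a power of the map turns out to be minimal and
    weakly mixing on the pieces of a finite clopen partition of [M]. Write [f]
    for the restricted map, [p] for the projection, [N] for the bound on the
    fibres, and consider the closed sets that are invariant under [f * f] in
    [M * M] and have nonempty interior.

    By weak mixing of [S], [p * p] maps each of these sets onto [Y * Y]. If
    several of them overlap pairwise in nowhere dense sets, then the images of
    the overlaps do not fill [Y * Y], because a semi-open map with bounded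
    fibres keeps nowhere dense sets small ([nowhere_dense_image]); in the fibre
    of a point outside these images the sets pick different points. Hence there
    are at most [N * N] of them ([interior_disjoint_bound_prod]). Since [f * f]
    is nonwandering, the closed complement of an invariant set is invariant
    ([closed_invariant_closureC]), so one can split until an indecomposable set
    [W] is reached ([component_exists]). On [W] the map [f * f] is transitive.

    The map [f * id] commutes with [f * f], so the preimages of [W] under its
    iterates belong to the same bounded family; two of them overlap, and this
    yields [d > 0] such that [W] is invariant under [f^d * id]
    ([component_commuting_map]), and also under [id * f^d]. The closures of the
    [f^d]-orbits are clopen minimal pieces of [M], and so [W] contains a product
    of two pieces. Transporting by iterates of [f], one gets on each piece [D]
    that for open subsets [U], [U'], [V], [V'] of [D] some [n] sends points of
    [U] into [U'] and points of [V] into [V'] ([power_weak_mixing]).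

    From here on the argument is the classical one for minimal weakly mixing
    systems. For open [U], [V] in the piece of [x], the times at which [U] meets
    [V] contain long progressions of difference [d], and [x] visits [V] along
    multiples of [d] with bounded gaps, so that [x] and some point of [U] are in
    [V] at the same time ([weak_mixing_on_meet]). Sensitivity comes from [Y],
    which has two points ([semi_open_extension_sensitive]). A Baire
    category argument inside the piece of [x] combines the two properties. *)

(** * Preliminaries on compact spaces *)

Lemma compact_seq_cluster (X : topologicalType) (u : nat -> X) :
  compact [set: X] -> exists z, forall V, open V -> V z ->
    forall m, exists2 k, (m <= k)%N & V (u k).
Proof.
move=> cX; have [z [_ cz]] := cX (u @ \oo) _ filterT.
exists z => V oV Vz m.
have um : (u @ \oo) (u @` [set k | (m <= k)%N]).
  by exists m => // k /= mk; exists k.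
have [_ [[k mk <-] Vk]] := cz _ _ um (open_nbhs_nbhs (conj oV Vz)).
by exists k.
Qed.

Lemma continuous_iter (X : topologicalType) (f : X -> X) k :
  continuous f -> continuous (iter k f).
Proof.
move=> cf; elim: k => [|k IH] x; first exact: cvg_id.
by apply: continuous_comp; [exact: IH|exact: cf].
Qed.

Lemma open_preimage (X Y : topologicalType) (f : X -> Y) U :
  continuous f -> open U -> open (f @^-1` U).
Proof. by move=> /continuousP; exact. Qed.

Lemma closed_preimage (X Y : topologicalType) (f : X -> Y) F :
  continuous f -> closed F -> closed (f @^-1` F).
Proof. by move=> /continuous_closedP; exact. Qed.

Lemma compact_image_closed (X Y : topologicalType) (f : X -> Y) F :
  compact [set: X] -> hausdorff_space Y -> continuous f -> closed F ->
  closed (f @` F).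
Proof.
move=> cX hY cf cF; apply: compact_closed => //.
apply: continuous_compact; first exact: continuous_subspaceT.
exact: subclosed_compact cF cX _.
Qed.

Lemma range_iter (X : Type) (f : X -> X) k :
  range f = [set: X] -> range (iter k f) = [set: X].
Proof.
move=> rf; apply/seteqP; split => // x _; elim: k x => [|k IH] x.
  by exists x.
have [y _ <-] : range f x by rewrite rf.
by have [z _ <-] := IH y; exists z.
Qed.

Lemma open_setD (X : topologicalType) (U A : set X) :
  open U -> closed A -> open (U `\` A).
Proof. by move=> oU cA; rewrite setDE; apply: openI => //; exact: closed_openC. Qed.

(** * Nowhere dense sets and semi-open maps *)

Section nowhere_dense.
Context {X : topologicalType}.
Implicit Types A B : set X.

Definition closed_nowhere_dense A := closed A /\ A° = set0.

Lemma closed_nowhere_denseP A U : closed_nowhere_dense A -> open U ->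
  U !=set0 -> U `\` A !=set0.
Proof.
move=> [cA A0] oU /set0P/eqP U0; apply/set0P/eqP => UA; apply: U0.
by rewrite -subset0 -A0 -(open_subsetE _ oU); rewrite -setD_eq0.
Qed.

Lemma closed_nowhere_denseU A B : closed_nowhere_dense A ->
  closed_nowhere_dense B -> closed_nowhere_dense (A `|` B).
Proof.
move=> nA [cB B0]; have [cA A0] := nA; split; first exact: closedU.
apply/eqP/negPn/negP => /set0P AB.
have [z [ABz Az]] := closed_nowhere_denseP nA (open_interior _) AB.
suff : B° z by rewrite B0.
have oD : open ((A `|` B)° `\` A) by apply: open_setD => //; exact: open_interior.
apply: filterS (open_nbhs_nbhs (conj oD (conj ABz Az))).
by move=> w [/interior_subset[]].
Qed.

Lemma closed_nowhere_dense_bigcup (F : nat -> set X) r :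
  (forall i, (i < r)%N -> closed_nowhere_dense (F i)) ->
  closed_nowhere_dense (\bigcup_(i < r) F i).
Proof.
elim: r => [|r IH] nF.
  by rewrite II0 bigcup_set0; split; [exact: closed0|exact: interior0].
rewrite bigcup_mkord big_ord_recr /= -bigcup_mkord.
apply: closed_nowhere_denseU; last exact: nF.
by apply: IH => i ir; apply: nF; exact: ltnW.
Qed.

End nowhere_dense.

Definition semi_open (X Y : topologicalType) (f : X -> Y) :=
  forall U : set X, open U -> U !=set0 ->
    exists V : set Y, [/\ open V, V !=set0 & V `<=` f @` U].

Lemma semi_open_comp (X Y Z : topologicalType) (f : X -> Y) (g : Y -> Z) :
  semi_open f -> semi_open g -> semi_open (g \o f).
Proof.
move=> sf sg U oU U0; have [V [oV V0 VU]] := sf _ oU U0.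
have [W [oW W0 WV]] := sg _ oV V0; exists W; split=> //.
by move=> w /WV[v /VU[u Uu <-] <-]; exists u.
Qed.

Lemma semi_open_iter (X : topologicalType) (f : X -> X) k :
  semi_open f -> semi_open (iter k f).
Proof.
move=> sf; elim: k => [|k IH] /=; last exact: semi_open_comp IH sf.
by move=> U oU U0; exists U; split=> // u Uu; exists u.
Qed.

Lemma open_setX (X Y : topologicalType) (U : set X) (V : set Y) :
  open U -> open V -> open (U `*` V).
Proof.
move=> oU oV.
have -> : U `*` V = (fst @^-1` U) `&` (snd @^-1` V) by [].
by apply: openI; apply: open_preimage => // -[a b]; [exact: cvg_fst|exact: cvg_snd].
Qed.

Lemma open_setX_sub (X Y : topologicalType) (W : set (X * Y)) a b :
  open W -> W (a, b) ->
  exists U V, [/\ open U, open V, U a, V b & U `*` V `<=` W].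
Proof.
move=> oW Wab; have [[A B] /= [nA nB] ABW] : nbhs (a, b) W by exact: open_nbhs_nbhs.
exists A°, B°; split; try exact: open_interior; rewrite ?/interior //.
by move=> [c d] /= [/interior_subset Ac /interior_subset Bd]; apply: ABW.
Qed.

Lemma hausdorff_prod (X Y : topologicalType) :
  hausdorff_space X -> hausdorff_space Y -> hausdorff_space (X * Y)%type.
Proof.
move=> hX hY [a b] [c d] cl; congr pair; [apply: hX|apply: hY] => A B nA nB.
  have [||[u v] [[Au _] [Bu _]]] := cl (A `*` setT) (B `*` setT).
  - by exists (A, setT) => //; split=> //; exact: filterT.
  - by exists (B, setT) => //; split=> //; exact: filterT.
  - by exists u.
have [||[u v] [[_ Av] [_ Bv]]] := cl (setT `*` A) (setT `*` B).
- by exists (setT, A) => //; split=> //; exact: filterT.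
- by exists (setT, B) => //; split=> //; exact: filterT.
- by exists v.
Qed.

Lemma continuous_prod_map (X Y X' Y' : topologicalType) (f : X -> X')
    (g : Y -> Y') : continuous f -> continuous g ->
  continuous (fun q : X * Y => (f q.1, g q.2)).
Proof.
move=> cf cg [x y]; apply: cvg_pair.
  by apply: (@continuous_comp _ _ _ fst f (x, y)); [exact: cvg_fst|exact: cf].
by apply: (@continuous_comp _ _ _ snd g (x, y)); [exact: cvg_snd|exact: cg].
Qed.

Lemma semi_open_prod_map (X Y X' Y' : topologicalType) (f : X -> X')
    (g : Y -> Y') : semi_open f -> semi_open g ->
  semi_open (fun q : X * Y => (f q.1, g q.2)).
Proof.
move=> sf sg W oW [[a b] /(open_setX_sub oW)[U [V [oU oV Ua Vb UVW]]]].
have [U' [oU' [a' Ua'] UU']] := sf _ oU (ex_intro _ _ Ua).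
have [V' [oV' [b' Vb'] VV']] := sg _ oV (ex_intro _ _ Vb).
exists (U' `*` V'); split; first exact: open_setX.
  by exists (a', b').
move=> [c d] /= [/UU'[u Uu <-] /VV'[v Vv <-]].
by exists (u, v) => //; exact: UVW.
Qed.

(** Sequences without repetition avoid cardinals and behave well under
    products. *)
Definition fibres_le (X : eqType) (Y : Type) (f : X -> Y) (N : nat) :=
  forall y (s : seq X), uniq s -> (forall x, x \in s -> f x = y) ->
    (size s <= N)%N.

Lemma fibres_le_prod_map (X X' : eqType) (Y Y' : Type) (f : X -> Y)
    (g : X' -> Y') m n : fibres_le f m -> fibres_le g n ->
  fibres_le (fun q : X * X' => (f q.1, g q.2)) (m * n).
Proof.
move=> fm gn [y y'] s us fs.
pose s1 := undup (map fst s); pose s2 := undup (map snd s).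
have ss : (size s <= size [seq (a, b) | a <- s1, b <- s2])%N.
  apply: uniq_leq_size => // -[a b] abs.
  by apply: allpairs_f; rewrite mem_undup; apply/mapP; exists (a, b).
apply: (leq_trans ss); rewrite size_allpairs; apply: leq_mul.
  apply: (fm y); first exact: undup_uniq.
  by move=> a; rewrite mem_undup => /mapP[q /fs[<- _] ->].
apply: (gn y'); first exact: undup_uniq.
by move=> a; rewrite mem_undup => /mapP[q /fs[_ <-] ->].
Qed.

Lemma open_regular (X : uniformType) (U : set X) : open U -> U !=set0 ->
  exists V, [/\ open V, V !=set0 & closure V `<=` U].
Proof.
move=> oU [x Ux]; have [V nV VU] := uniform_regular (open_nbhs_nbhs (conj oU Ux)).
exists V°; split; first exact: open_interior.
  by exists x; exact: nV.
exact: subset_trans (closure_subset (@interior_subset _ V)) VU.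
Qed.

(** Suppose that the image of [A] covers [O]. Over an open part of [O], and
    outside a closed set [D] that misses [A], there are points of [A], hence open
    sets off [A]; the image of one of them contains a smaller open part of [O].
    Adding its closure to [D] and repeating puts ever more points in a fibre. *)
Lemma nowhere_dense_image (X : uniformType) (Y : topologicalType) (f : X -> Y)
    N A O : continuous f -> semi_open f -> fibres_le f N ->
  closed_nowhere_dense A -> open O -> O !=set0 -> ~ O `<=` f @` A.
Proof.
move=> cf sf fN nA oO O0 OA; have [cA _] := nA.
suff [V [D [[_ [y Vy] _] [_ _ /(_ _ Vy)[s [us sN _ /fN]]]]]] :
    exists V D, [/\ open V, V !=set0 & V `<=` O] /\
      [/\ closed D, D `&` A = set0 &
      forall y, V y -> exists s, [/\ uniq s, size s = N.+1,
        {in s, forall x, D x} & {in s, forall x, f x = y}]].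
  by move=> /(_ us); rewrite sN ltnn.
elim: N.+1 => [|k [V [D [[oV [y Vy] VO] [cD DA VD]]]]].
  by exists O, set0; split; split => //; [exact: closed0|rewrite set0I|exists [::]].
pose W := f @^-1` V `\` D.
have oW : open W by apply: open_setD => //; exact: open_preimage.
have W0 : W !=set0.
  have [a Aa fa] := OA _ (VO _ Vy); exists a; split; first by rewrite /= fa.
  by move=> Da; have : (D `&` A) a by []; rewrite DA.
have WA0 := closed_nowhere_denseP nA oW W0.
have [U [oU U0 UW]] := open_regular (open_setD oW cA) WA0.
have [V' [oV' V'0 V'U]] := sf _ oU U0.
have V'V : V' `<=` V.
  by move=> z /V'U[u /subset_closure/UW[[Vfu _] _] <-].
exists V', (D `|` closure U); do 2?split => //.
- exact: subset_trans V'V VO.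
- by apply: closedU => //; exact: closed_closure.
- by rewrite setIUl DA set0U -subset0 => x [/UW[_ nAx] /nAx].
- move=> z V'z; have [s [us sk sD fs]] := VD _ (V'V _ V'z).
  have [u Uu fu] := V'U _ V'z; have [[_ nDu] _] := UW _ (subset_closure Uu).
  exists (u :: s); split => /=.
  + by rewrite us andbT; apply/negP => /sD.
  + by rewrite sk.
  + move=> x; rewrite inE => /predU1P[->|/sD]; last by left.
    by right; exact: subset_closure.
  + by move=> x; rewrite inE => /predU1P[->|/fs].
Qed.

(** * Minimal maps *)

Lemma bounded_hitting (X : topologicalType) (f : X -> X) (C U : set X) :
  compact [set: X] -> continuous f -> closed C -> open U ->
  (forall x, C x -> exists k, U (iter k f x)) ->
  exists K, forall x, C x -> exists2 k, (k <= K)%N & U (iter k f x).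
Proof.
move=> cX cf cC oU CU; apply: contrapT => /forallNP noK.
have /choice[x xU] : forall K, exists x,
    C x /\ forall k, (k <= K)%N -> ~ U (iter k f x).
  move=> K; have /existsNP[x /not_implyP[Cx xK]] := noK K.
  by exists x; split=> // k kK Uk; apply: xK; exists k.
have [z clz] := compact_seq_cluster x cX.
have Cz : C z.
  apply: contrapT => nCz; have [k _] := clz _ (closed_openC cC) nCz 0.
  by apply; have [] := xU k.
have [k Uk] := CU z Cz.
have [m km Vm] := clz _ (open_preimage (@continuous_iter _ _ k cf) oU) Uk k.
by have [_ /(_ _ km)] := xU m; apply.
Qed.

Section minimal_maps.
Context {X : topologicalType} (f : X -> X).
Hypotheses (cX : compact [set: X]) (cf : continuous f) (mf : minimal_map f).

Lemma minimal_bounded_hitting U : open U -> U !=set0 ->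
  exists K, forall x, exists2 k, (k <= K)%N & U (iter k f x).
Proof.
move=> oU U0; have [|K UK] := bounded_hitting cX cf closedT oU.
  move=> x _; have [w [Uw [k _ wE]]] := mf x U0 oU.
  by exists k; rewrite wE.
by exists K => x; exact: UK.
Qed.

Lemma minimal_closed_invariant F : closed F -> F !=set0 ->
  (forall x, F x -> F (f x)) -> F = [set: X].
Proof.
move=> cF [x Fx] fF; apply/seteqP; split=> // y _; apply: contrapT => nFy.
have orb k : F (iter k f x) by elim: k => //= k; exact: fF.
have nF0 : ~` F !=set0 by exists y.
by have [w [nFw [k _ kE]]] := mf x nF0 (closed_openC cF); apply: nFw; rewrite -kE.
Qed.

Lemma minimal_surjective : hausdorff_space X -> range f = [set: X].
Proof.
move=> hX; have [[x _]|/nonemptyPn X0] := pselect ([set: X] !=set0).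
  apply: minimal_closed_invariant; last by move=> y _; exists y.
    exact: compact_image_closed closedT.
  by exists (f x), x.
by apply/seteqP; split=> // y; rewrite X0.
Qed.

(** The complement of [f @` (~` U)] is an open subset of [f @` U]. Were it empty,
    every point would have backward orbits of any length avoiding [U], although
    every orbit enters [U] within a bounded time. *)
Lemma minimal_semi_open : hausdorff_space X -> semi_open f.
Proof.
move=> hX U oU U0; exists (~` (f @` (~` U))); split.
- by apply: closed_openC; apply: compact_image_closed => //; exact: open_closedC.
- apply: contrapT => /nonemptyPn E.
  have back k y : exists z, iter k f z = y /\
      forall i, (i < k)%N -> ~ U (iter i f z).
    elim: k y => [|k IH] y; first by exists y.
    have [w nUw wy] : (f @` (~` U)) y.
      by apply: contrapT => ny; have : (~` (f @` (~` U))) y by []; rewrite E.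
    have [z [zw zU]] := IH w; exists z; split; first by rewrite /= zw.
    move=> i; rewrite ltnS leq_eqVlt => /predU1P[->|]; last exact: zU.
    by rewrite zw.
  have [K UK] := minimal_bounded_hitting oU U0.
  have [x _] := U0; have [z [_ zU]] := back K.+1 x.
  by have [k kK] := UK z; exact: zU.
- move=> y ny; have [x _ xy] : range f y by rewrite minimal_surjective.
  by exists x => //; apply: contrapT => nUx; apply: ny; exists x.
Qed.

(** Fix a point [x] and a point [y]. The pair of waiting times, until the orbit
    of [x] enters [U] and that of [y] enters [V], takes finitely many values, so
    it is the same from two different starting times [i < j]; then [j - i] is a
    return time for both sets. *)
Lemma minimal_common_return U V : open U -> open V -> U !=set0 -> V !=set0 ->
  exists i x y, [/\ U x, U (iter i.+1 f x), V y & V (iter i.+1 f y)].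
Proof.
move=> oU oV U0 V0; have [x _] := U0; have [y _] := V0.
have [K UK] := minimal_bounded_hitting oU U0.
have [L VL] := minimal_bounded_hitting oV V0.
have /choice[a aP] i : exists k : 'I_K.+1, U (iter (k + i) f x).
  by have [k kK Uk] := UK (iter i f x);
    exists (Ordinal (kK : (k < K.+1)%N)); rewrite iterD.
have /choice[b bP] i : exists l : 'I_L.+1, V (iter (l + i) f y).
  by have [k kK Uk] := VL (iter i f y);
    exists (Ordinal (kK : (k < L.+1)%N)); rewrite iterD.
pose N := #|{: 'I_K.+1 * 'I_L.+1}|.
have /injectivePn[i [j nij [ea eb]]] :
    ~~ injectiveb (fun i : 'I_N.+1 => (a i, b i)).
  apply/negP => /injectiveP/leq_card; rewrite -/N card_ord ltnn //.
wlog ij : i j nij ea eb / (i < j)%N.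
  move=> H; have := nij; rewrite -val_eqE neq_ltn => /orP[|] lt; first exact: (H i j).
  by apply: (H j i) => //; rewrite eq_sym.
have jE k : (k + j = (j - i.+1).+1 + (k + i))%N.
  by rewrite addnCA -subSn // subSS subnK // ltnW.
exists (j - i.+1)%N, (iter (a i + i) f x), (iter (b i + i) f y).
by split=> //; rewrite -iterD -jE ?ea ?eb.
Qed.

End minimal_maps.

(** A minimal system is a finite union of preimages of any nonempty open set
    under iterates of [f], so the image of one of them has interior, which the
    semi-open iterate of [S] carries into the image of the given set. *)
Lemma minimal_factor_semi_open (X : uniformType) (Y : topologicalType)
    (f : X -> X) (S : Y -> Y) (p : X -> Y) :
  compact [set: X] -> hausdorff_space Y -> continuous f -> minimal_map f ->
  semi_open S -> continuous p -> range p = [set: Y] ->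
  (forall x, p (f x) = S (p x)) -> semi_open p.
Proof.
move=> cX hY cf mf sS cp rp pf U oU U0.
have [V [oV V0 VU]] := open_regular oU U0.
have [K VK] := minimal_bounded_hitting cX cf mf oV V0.
have pk k x : p (iter k f x) = iter k S (p x) by elim: k => //= k <-.
pose F k := p @` (iter k f @^-1` closure V).
have cF k : closed (F k).
  apply: compact_image_closed => //; apply: closed_preimage.
    exact: continuous_iter.
  exact: closed_closure.
have [k Fk0] : exists k, (F k)° !=set0.
  apply: contrapT => /forallNP nF.
  have nd : closed_nowhere_dense (\bigcup_(i < K.+1) F i).
    apply: closed_nowhere_dense_bigcup => i _; split; first exact: cF.
    by apply/eqP/negPn/negP => /set0P/nF.
  have [x _] := U0.
  have T0 : [set: Y] !=set0 by exists (p x).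
  have [y [_]] := closed_nowhere_denseP nd openT T0; apply.
  have [z _ <-] : range p y by rewrite rp.
  by have [k kK Vk] := VK z; exists k => //; exists z => //; exact: subset_closure.
have [W [oW W0 WF]] := @semi_open_iter _ _ k sS _ (open_interior (F k)) Fk0.
exists W; split=> // _ /WF[_ /interior_subset[x Vx <-] <-].
by rewrite -pk; exists (iter k f x) => //; exact: VU.
Qed.

(** * Components of a nonwandering map *)

Section invariant_sets.
Context {Z : topologicalType} (t : Z -> Z).
Implicit Types V W : set Z.

Definition closed_invariant W := closed W /\ (forall z, W z -> W (t z)).

Definition nonwandering := forall U, open U -> U !=set0 ->
  exists i z, U z /\ U (iter i.+1 t z).

Lemma closed_invariantI V W : closed_invariant V -> closed_invariant W ->
  closed_invariant (V `&` W).
Proof.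
move=> [cV tV] [cW tW]; split; first exact: closedI.
by move=> z [/tV ? /tW].
Qed.

(** If [t] moved a point of [closure (~` W)] out of this closure, a nonempty open
    set disjoint from [W] would be mapped into [W] and never return. *)
Lemma closed_invariant_closureC W : continuous t -> nonwandering ->
  closed_invariant W -> closed_invariant (closure (~` W)).
Proof.
move=> ct nw [cW tW]; split; first exact: closed_closure.
move=> z clz; apply: contrapT => ntz.
have Wtz : W° (t z) by rewrite -[W]setCK interiorC.
pose A := t @^-1` W° `\` W.
have oA : open A by apply: open_setD => //; exact: open_preimage (open_interior _).
have A0 : A !=set0.
  have nz : nbhs z (t @^-1` W°).
    by apply: open_nbhs_nbhs; split=> //; exact: open_preimage (open_interior _).
  by have [w [nWw tw]] := clz _ nz; exists w.
have [i [w [[/interior_subset Wtw _] [_]]]] := nw _ oA A0; apply.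
by rewrite iterSr; elim: i => //= i /tW.
Qed.

Lemma closed_invariant_closure W : continuous t ->
  (forall z, W z -> W (t z)) -> closed_invariant (closure W).
Proof.
move=> ct tW; split; first exact: closed_closure.
move=> z clz A /ct /clz[w [Ww Aw]]; exists (t w).
by split=> //; exact: tW.
Qed.

(** A bound on the number of closed invariant sets with interior which overlap
    at most in nowhere dense sets. *)
Definition interior_disjoint_bound N := forall r (F : nat -> set Z),
  (forall i, (i < r)%N -> closed_invariant (F i) /\ (F i)° !=set0) ->
  (forall i j, (i < j < r)%N -> (F i `&` F j)° = set0) -> (r <= N)%N.

(** An indecomposable invariant set: it cannot be cut by another closed
    invariant set into two parts with interior. *)
Definition component W := [/\ closed_invariant W, W° !=set0 &
  forall V, closed_invariant V -> (V `&` W)° !=set0 -> W `<=` V].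

(** Without components, every closed invariant set with interior would split
    into two such sets with disjoint interiors, and so into arbitrarily many:
    if [V] cuts [W], the two parts are [V `&` W] and the trace on [W] of the
    closed complement of [V]. *)
Lemma component_exists N : continuous t -> nonwandering -> [set: Z] !=set0 ->
  interior_disjoint_bound N -> exists W, component W.
Proof.
move=> ct nw Z0 bN; apply: contrapT => noC.
pose fat W := closed_invariant W /\ W° !=set0.
have split2 W : fat W -> exists V1 V2,
    [/\ fat V1, fat V2, V1 `<=` W, V2 `<=` W & (V1 `&` V2)° = set0].
  move=> [iW [w Ww]]; pose W' := closure W°.
  (* The regular part of [W] is used: its interior is dense in it, so that any
     closed set not containing it leaves a part with interior. *)
  have iC A : closed_invariant A -> closed_invariant (closure (~` A)).
    exact: closed_invariant_closureC.
  have iW' : closed_invariant W'.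
    by rewrite /W' -[W]setCK interiorC; apply/iC/iC.
  have W'W : W' `<=` W.
    by have [/closure_id cW _] := iW; rewrite [X in _ `<=` X]cW;
      apply: closure_subset; exact: interior_subset.
  have W'i : W° `<=` W'°.
    by rewrite -open_subsetE; [exact: subset_closure|exact: open_interior].
  have [V [iV VW nWV]] : exists V, [/\ closed_invariant V, (V `&` W')° !=set0 &
      ~ W' `<=` V].
    apply: contrapT => noV; apply: noC; exists W'; split=> //.
      by exists w; exact: W'i.
    by move=> V iV VW; apply: contrapT => nWV; apply: noV; exists V.
  have [cV _] := iV.
  have [z [Wz nVz]] : W° `\` V !=set0.
    apply: contrapT => /nonemptyPn; rewrite setD_eq0 => WV; apply: nWV.
    by have /closure_id -> := cV; exact: closure_subset.
  exists (V `&` W'), (W' `&` closure (~` V)); split.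
  - by split=> //; exact: closed_invariantI.
  - split; first by apply: closed_invariantI => //; exact: iC.
    have oD := open_setD (open_interior W) cV.
    exists z; apply: filterS (open_nbhs_nbhs (conj oD (conj Wz nVz))).
    move=> u [Wu nVu]; split; first exact: subset_closure.
    exact: subset_closure.
  - by move=> u [_ /W'W].
  - by move=> u [/W'W].
  - rewrite -subset0 => u Iu.
    have /interior_subset[_ [_ clu]] := Iu.
    have [v [nVv /interior_subset[[Vv _] _]]] :=
      clu _ (open_nbhs_nbhs (conj (open_interior _) Iu)).
    exact: nVv.
have many r W : fat W -> exists F : nat -> set Z,
    [/\ forall i, (i < r)%N -> fat (F i), forall i, (i < r)%N -> F i `<=` W &
      forall i j, (i < j < r)%N -> (F i `&` F j)° = set0].
  elim: r W => [|r IH] W fW.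
    by exists (fun=> W); split=> // i j; rewrite ltn0 andbF.
  have [V1 [V2 [fV1 fV2 V1W V2W V12]]] := split2 _ fW.
  have [F [fF FV2 FF]] := IH _ fV2.
  exists (fun i => if i is i'.+1 then F i' else V1); split.
  - by case=> // i; exact: fF.
  - by case=> // i ir; apply: subset_trans V2W; exact: FV2.
  - case=> [|i] [|j] //; last exact: FF.
    rewrite /= ltnS => jr; rewrite -subset0 -V12; apply: interiorS.
    by apply: setIS; exact: FV2.
have fT : fat [set: Z].
  by split; [split=> //; exact: closedT|rewrite interiorT].
have [F [fF _ FF]] := many N.+1 _ fT.
by have := bN _ F fF FF; rewrite ltnn.
Qed.

(** The orbit closure of [U] is an invariant set that overlaps [W] in a set
    with interior, so it contains [W]. *)
Lemma component_transitive W U V : continuous t -> component W ->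
  open U -> open V -> U !=set0 -> V !=set0 -> U `<=` W -> V `<=` W ->
  exists n z, U z /\ V (iter n t z).
Proof.
move=> ct [_ _ mW] oU oV [u Uu] [v Vv] UW VW.
pose O := [set w | exists n z, U z /\ iter n t z = w].
have iO : closed_invariant (closure O).
  apply: closed_invariant_closure => // w [n [z [Uz <-]]].
  by exists n.+1, z.
have UO : U `<=` closure O `&` W.
  by move=> z Uz; split; [apply: subset_closure; exists 0, z|exact: UW].
have OW : (closure O `&` W)° !=set0.
  by exists u; apply: filterS (open_nbhs_nbhs (conj oU Uu)).
have clv := mW _ iO OW _ (VW _ Vv).
have [w [[n [z [Uz zw]]] Vw]] := clv _ (open_nbhs_nbhs (conj oV Vv)).
by exists n, z; rewrite zw.
Qed.

(** The preimages of [W] under the iterates of [g] are closed invariant sets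
    with interior; two of them overlap, and pushing the overlap forward shows
    that a power of [g] sends part of the interior of [W] into [W]. *)
Lemma component_commuting_map N W (g : Z -> Z) : component W ->
  interior_disjoint_bound N -> continuous g -> range g = [set: Z] ->
  semi_open g -> (forall z, g (t z) = t (g z)) ->
  exists2 d, (0 < d)%N & forall z, W z -> W (iter d g z).
Proof.
move=> [[cW tW] [w Ww] mW] bN cg rg sg gt.
have itg i z : iter i g (t z) = t (iter i g z).
  by elim: i => //= i ->; rewrite gt.
pose F i := iter i g @^-1` W.
have cgi i : continuous (iter i g) by exact: continuous_iter.
have iF i : closed_invariant (F i).
  split; first exact: closed_preimage.
  by move=> z; rewrite /F /= itg; exact: tW.
have F0 i : (F i)° !=set0.
  have [z _ zw] : range (iter i g) w by rewrite range_iter.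
  have oP := open_preimage (cgi i) (open_interior W).
  have Pz : (iter i g @^-1` W°) z by rewrite /= zw.
  exists z; apply: filterS (open_nbhs_nbhs (conj oP Pz)) => u.
  exact: interior_subset.
have [i [j [ij FF]]] : exists i j, (i < j)%N /\ (F i `&` F j)° !=set0.
  apply: contrapT => no; suff : (N.+1 <= N)%N by rewrite ltnn.
  apply: (bN _ F) => [i _|i j /andP[ij _]]; first by split.
  by apply/eqP/negPn/negP => /set0P FF; apply: no; exists i, j.
have [P [oP [q Pq] PF]] := @semi_open_iter _ _ i sg _ (open_interior _) FF.
exists (j - i)%N; first by rewrite subn_gt0.
apply: (mW _ (iF (j - i)%N)); exists q.
apply: filterS (open_nbhs_nbhs (conj oP Pq)) => _ /PF[z /interior_subset[Fi Fj] <-].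
by split=> //; rewrite /F /= -iterD subnK // ltnW.
Qed.

End invariant_sets.

(** * Orbit closures under a power of a minimal map *)

Section orbit_closures.
Context {X : topologicalType}.
Implicit Types (f : X -> X) (F : set X).

Definition orbit_closure f x := closure (forward_orbit f x).

Lemma orbit_closure_self f x : orbit_closure f x x.
Proof. by apply: subset_closure; exists 0%N. Qed.

Lemma orbit_closure_closed f x : closed (orbit_closure f x).
Proof. exact: closed_closure. Qed.

Lemma orbit_closure_sub f F x : closed_invariant f F -> F x ->
  orbit_closure f x `<=` F.
Proof.
move=> [/closure_id cF fF] Fx; rewrite [X in _ `<=` X]cF; apply: closure_subset.
by move=> _ [k _ <-]; elim: k => //= k; exact: fF.
Qed.

Lemma orbit_closure_invariant f x : continuous f ->
  closed_invariant f (orbit_closure f x).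
Proof.
by move=> cf; apply: closed_invariant_closure => // _ [k _ <-]; exists k.+1.
Qed.

End orbit_closures.

Section powers_of_minimal_maps.
Context {X : topologicalType} (f : X -> X) (d : nat).
Hypotheses (cX : compact [set: X]) (hX : hausdorff_space X).
Hypotheses (cf : continuous f) (mf : minimal_map f) (d0 : (0 < d)%N).

Let D := orbit_closure (iter d f).

Let cfi k : continuous (iter k f). Proof. exact: continuous_iter. Qed.

Let iD x : closed_invariant (iter d f) (D x).
Proof. exact: orbit_closure_invariant. Qed.

Let iter_comm k l x : iter k f (iter l f x) = iter l f (iter k f x).
Proof. by rewrite -!iterD addnC. Qed.

Let image_invariant k x : closed_invariant (iter d f) (iter k f @` D x).
Proof.
have [cD fD] := iD x; split; first exact: compact_image_closed.
by move=> _ [y Dy <-]; rewrite iter_comm; exists (iter d f y) => //; exact: fD.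
Qed.

Lemma power_orbit_closure_iter k x :
  iter k f @` orbit_closure (iter d f) x = orbit_closure (iter d f) (iter k f x).
Proof.
apply/seteqP; split.
  move=> _ [y Dy <-].
  have [cD fD] := iD (iter k f x).
  have iP : closed_invariant (iter d f) (iter k f @^-1` D (iter k f x)).
    split; first exact: closed_preimage.
    by move=> z; rewrite /= iter_comm; exact: fD.
  by apply: (orbit_closure_sub iP _ Dy); exact: orbit_closure_self.
apply: orbit_closure_sub; first exact: image_invariant.
by exists x => //; exact: orbit_closure_self.
Qed.

Let cover x z : exists2 i, (i < d)%N & (iter i f @` D x) z.
Proof.
suff E : \bigcup_(i < d) (iter i f @` D x) = [set: X].
  by have : [set: X] z by []; rewrite -E.
apply: (minimal_closed_invariant mf).
- apply: closed_bigcup; first exact: finite_II.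
  by move=> i _; have [] := image_invariant i x.
- by exists x; exists 0%N => //; exists x => //; exact: orbit_closure_self.
- move=> _ [i /= id [y Dy <-]]; have [idd|] := ltnP i.+1 d.
    by exists i.+1 => //; exists y.
  rewrite leq_eqVlt ltnS leqNgt id orbF => /eqP di.
  exists 0%N => //; exists (iter d f y) => //; last by rewrite di.
  by have [_] := iD x; apply.
Qed.

(** With [x] equal to [iter i f w] for some [w] in the orbit closure of [y],
    the inclusions [D x <= f^i (D y) <= f^i (D x)] can be iterated until the
    exponent is a multiple of [d]. *)
Lemma power_orbit_closure_sym x y : orbit_closure (iter d f) x y ->
  orbit_closure (iter d f) y x.
Proof.
move=> Dxy; have [i _ [w Dw wx]] := cover y x.
have DyDx : D y `<=` D x by apply: orbit_closure_sub.
have Dxi : D x `<=` iter i f @` D y.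
  by apply: orbit_closure_sub => //; exists w.
have Dxm m : D x `<=` iter (m.+1 * i) f @` D y.
  elim: m => [|m IH]; first by rewrite mul1n.
  move=> z /Dxi[v /DyDx/IH[u Du <-] <-]; exists u => //.
  by rewrite mulSn iterD.
have [v Dv <-] := Dxm d.-1 x (@orbit_closure_self _ _ x).
rewrite prednK // mulnC iterM; have [_ fD] := iD y.
by elim: (i) => //= k; exact: fD.
Qed.

Lemma power_orbit_closure_eq x y : orbit_closure (iter d f) x y ->
  orbit_closure (iter d f) y = orbit_closure (iter d f) x.
Proof.
by move=> Dxy; apply/seteqP; split; apply: orbit_closure_sub => //;
  exact: power_orbit_closure_sym.
Qed.

(** The pieces through the first [d] points of the orbit of [x] cover the space,
    and two pieces are equal or disjoint. *)
Lemma power_orbit_closure_open x : open (orbit_closure (iter d f) x).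
Proof.
rewrite -[orbit_closure _ _]setCK; apply: closed_openC.
pose F i := if x \in D (iter i f x) then set0 else D (iter i f x).
rewrite (_ : ~` _ = \bigcup_(i < d) F i).
  apply: closed_bigcup; first exact: finite_II.
  move=> i _; rewrite /F; case: ifP => _; first exact: closed0.
  exact: orbit_closure_closed.
apply/seteqP; split => [z nDz|z [i _]].
  have [i id] := cover x z; rewrite power_orbit_closure_iter => Dz.
  exists i => //; rewrite /F; case: ifPn => // /set_mem Dx; apply: nDz.
  by rewrite (power_orbit_closure_eq Dx).
rewrite /F; case: ifPn => // /negP nDx Dz Dxz; apply: nDx; apply/mem_set.
rewrite -/(D x) in Dxz; rewrite /D -(power_orbit_closure_eq Dz) /=.
by rewrite (power_orbit_closure_eq Dxz); exact: orbit_closure_self.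
Qed.

End powers_of_minimal_maps.

(** * Weak mixing of a power on the pieces of a finite extension *)

(** The iterates of [f] itself are used although [f] may permute several pieces
    such as [D]: a time [n] as below sends a point of [D] into [D]. *)
Definition weak_mixing_on (X : topologicalType) (f : X -> X) (D : set X) :=
  forall U U' V V' : set X, open U -> open U' -> open V -> open V' ->
    U !=set0 -> U' !=set0 -> V !=set0 -> V' !=set0 ->
    U `<=` D -> U' `<=` D -> V `<=` D -> V' `<=` D ->
  exists n, (exists2 u, U u & U' (iter n f u)) /\
            (exists2 v, V v & V' (iter n f v)).

Section finite_extensions.
Context {R : realType} {X Y : metricType R} (f : X -> X) (S : Y -> Y)
  (p : X -> Y) (N : nat).
Hypotheses (cX : compact [set: X]) (cf : continuous f) (mf : minimal_map f).
Hypotheses (cY : compact [set: Y]) (cS : continuous S) (mS : minimal_map S).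
Hypotheses (wS : weak_mixing S).
Hypotheses (cp : continuous p) (pf : forall x, p (f x) = S (p x)).
Hypotheses (pN : fibres_le p N) (X0 : [set: X] !=set0).

Let hX : hausdorff_space X := @metric_hausdorff R X.
Let hY : hausdorff_space Y := @metric_hausdorff R Y.
Let ff (q : X * X) := (f q.1, f q.2).
Let pp (q : X * X) := (p q.1, p q.2).

Let iter_ff k q : iter k ff q = (iter k f q.1, iter k f q.2).
Proof. by elim: k => [|k /= ->]; case: q. Qed.

Let cff : continuous ff. Proof. exact: continuous_prod_map. Qed.

Lemma minimal_factor_range : range p = [set: Y].
Proof.
apply: (minimal_closed_invariant mS).
- exact: compact_image_closed closedT.
- by have [x _] := X0; exists (p x), x.
- by move=> _ [x _ <-]; exists (f x).
Qed.

Lemma factor_semi_open : semi_open p.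
Proof.
apply: minimal_factor_semi_open cX hY cf mf _ cp minimal_factor_range pf.
exact: minimal_semi_open.
Qed.

Lemma nonwandering_prod : nonwandering ff.
Proof.
move=> W oW [[a b] /(open_setX_sub oW)[U [V [oU oV Ua Vb UVW]]]].
have [i [x [y [Ux Ui Vy Vi]]]] := minimal_common_return cX cf mf oU oV
  (ex_intro _ _ Ua) (ex_intro _ _ Vb).
by exists i, (x, y); split; [apply: UVW|rewrite iter_ff; apply: UVW].
Qed.

(** By weak mixing each of the sets is mapped onto [Y * Y], and their pairwise
    intersections, being nowhere dense, miss the fibre of some point; in this
    fibre the sets pick different points. *)
Lemma interior_disjoint_bound_prod : interior_disjoint_bound ff (N * N).
Proof.
move=> r F iF FF.
have cpp : continuous pp by exact: continuous_prod_map.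
have spp : semi_open pp by apply: semi_open_prod_map; exact: factor_semi_open.
have ppN : fibres_le pp (N * N) by exact: fibres_le_prod_map.
have cXX : compact [set: X * X] by rewrite -setXTT; exact: compact_setX.
have hYY : hausdorff_space (Y * Y)%type by exact: hausdorff_prod.
have onto i q : (i < r)%N -> exists2 z, F i z & pp z = q.
  move=> ir; have [[cFi fFi] Fi0] := iF i ir.
  have cpF : closed (pp @` F i) by exact: compact_image_closed.
  apply: contrapT => nq.
  have [A [oA A0 AF]] := spp _ (open_interior _) Fi0.
  have [k [_ [w [Aw nw]]]] := wS oA (closed_openC cpF) A0 (ex_intro _ q nq).
  apply: nw; have [z /interior_subset Fz zw] := AF _ Aw.
  exists (iter k ff z); first by elim: (k) => //= j; exact: fFi.
  by rewrite -zw; elim: (k) => //= j <-; rewrite /pp /ff /= !pf.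
pose G i j := if (i < j)%N then F i `&` F j else set0.
pose A := \bigcup_(i < r) \bigcup_(j < r) G i j.
have nA : closed_nowhere_dense A.
  apply: closed_nowhere_dense_bigcup => i ir.
  apply: closed_nowhere_dense_bigcup => j jr; rewrite /G; case: ifP => ij.
    split; last by apply: FF; rewrite ij.
    by apply: closedI; [have [[]] := iF i ir|have [[]] := iF j jr].
  by split; [exact: closed0|exact: interior0].
have T0 : [set: Y * Y] !=set0 by have [x _] := X0; exists (p x, p x).
have /existsNP[q /not_implyP[_ nq]] := nowhere_dense_image cpp spp ppN nA openT T0.
have [z0 _] := X0.
have /choice[a aP] : forall i, exists z, (i < r)%N -> F i z /\ pp z = q.
  move=> i; have [ir|_] := boolP (i < r)%N; last by exists (z0, z0).
  by have [z Fz zq] := onto i q ir; exists z.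
rewrite -(size_iota 0 r) -(size_map a); apply: (ppN q).
  rewrite map_inj_in_uniq ?iota_uniq // => i j.
  rewrite !mem_iota /= add0n => ir jr aij; apply/eqP; apply: contra_notT nq => nij.
  wlog ij : i j ir jr aij nij / (i < j)%N.
    move=> H; have := nij; rewrite neq_ltn => /orP[|] lt; first exact: (H i j).
    by apply: (H j i) => //; rewrite eq_sym.
  have [Fi zq] := aP i ir; have [Fj _] := aP j jr.
  exists (a i) => //; exists i => //; exists j => //.
  by rewrite /G ij; split=> //; rewrite aij.
by move=> z /mapP[i]; rewrite mem_iota /= add0n => ir ->; have [] := aP i ir.
Qed.

(** A component [W] is invariant under [f^d * id] and [id * f^d] for some [d], so
    it contains the product of the pieces [D a] and [D b] of any [(a, b)] in it.
    Transitivity of [W] gives the common times on this product, and [f]-iterates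
    that map [D a] and [D b] onto [D x] carry them to [D x]. *)
Lemma power_weak_mixing : exists2 d, (0 < d)%N &
  forall x, weak_mixing_on f (orbit_closure (iter d f) x).
Proof.
have XX0 : [set: X * X] !=set0 by have [x _] := X0; exists (x, x).
have bN := interior_disjoint_bound_prod.
have [W compW] := component_exists cff nonwandering_prod XX0 bN.
have [[cW tW] [[a b] /interior_subset Wab] _] := compW.
have rf := minimal_surjective cX cf mf hX.
have sf := minimal_semi_open cX cf mf hX.
have cid : continuous (@id X) by move=> x; exact: cvg_id.
have sid : semi_open (@id X) by move=> U oU U0; exists U; split=> // u Uu; exists u.
pose g1 (q : X * X) := (f q.1, id q.2); pose g2 (q : X * X) := (id q.1, f q.2).
have g1i k q : iter k g1 q = (iter k f q.1, q.2).
  by elim: k => [|k /= ->]; case: q.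
have g2i k q : iter k g2 q = (q.1, iter k f q.2).
  by elim: k => [|k /= ->]; case: q.
have [|d1 d10 Wd1] := component_commuting_map compW bN
    (continuous_prod_map cf cid) _ (semi_open_prod_map sf sid) (fun=> erefl).
  apply/seteqP; split=> // -[x y] _.
  by have [z _ <-] : range f x; [rewrite rf|exists (z, y)].
have [|d2 d20 Wd2] := component_commuting_map compW bN
    (continuous_prod_map cid cf) _ (semi_open_prod_map sid sf) (fun=> erefl).
  apply/seteqP; split=> // -[x y] _.
  by have [z _ <-] : range f y; [rewrite rf|exists (x, z)].
pose d := (d1 * d2)%N; have d0 : (0 < d)%N by rewrite muln_gt0 d10.
exists d => // x; pose D := orbit_closure (iter d f).
have Wd u v : W (u, v) -> W (iter d f u, v).
  move=> Wuv; rewrite -[(_, _)](g1i d (u, v)) /d mulnC iterM.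
  by elim: (d2) => //= k; exact: Wd1.
have Wd' u v : W (u, v) -> W (u, iter d f v).
  move=> Wuv; rewrite -[(_, _)](g2i d (u, v)) /d iterM.
  by elim: (d1) => //= k; exact: Wd2.
have cl u : closed [set v | W (u, v)].
  apply: (closed_preimage (f := fun v => (u, v))) cW.
  by move=> v; apply: cvg_pair; [exact: cvg_cst|exact: cvg_id].
have cl' v : closed [set u | W (u, v)].
  apply: (closed_preimage (f := fun u => (u, v))) cW.
  by move=> u; apply: cvg_pair; [exact: cvg_id|exact: cvg_cst].
have DW u v : D a u -> D b v -> W (u, v).
  move=> Du Dv; have Wub : [set u | W (u, b)] u.
    by apply: orbit_closure_sub Wab _ Du; split=> // z; exact: Wd.
  apply: (orbit_closure_sub (F := [set v | W (u, v)]) _ Wub Dv).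
  by split=> // z; exact: Wd'.
have oD z : open (D z) by exact: power_orbit_closure_open.
have hit z : exists k, iter k f @` D z = D x.
  have Dx0 : D x !=set0 by exists x; exact: orbit_closure_self.
  have [w [Dw [k _ wE]]] := mf z Dx0 (oD x).
  exists k; rewrite power_orbit_closure_iter //.
  by apply: power_orbit_closure_eq => //; rewrite wE.
have [k kD] := hit a; have [l lD] := hit b.
have pull j z U : iter j f @` D z = D x -> open U -> U !=set0 -> U `<=` D x ->
    open (D z `&` iter j f @^-1` U) /\ D z `&` iter j f @^-1` U !=set0.
  move=> jD oU [u Uu] UD; split.
    by apply: openI => //; apply: open_preimage => //; exact: continuous_iter.
  have : D x u by exact: UD.
  by rewrite -jD => -[w Dw wu]; exists w; split=> //=; rewrite wu.
move=> U U' V V' oU oU' oV oV' U0 U'0 V0 V'0 UD U'D VD V'D.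
have [oA [u Au]] := pull _ _ _ kD oU U0 UD.
have [oA' [u' Au']] := pull _ _ _ kD oU' U'0 U'D.
have [oB [v Bv]] := pull _ _ _ lD oV V0 VD.
have [oB' [v' Bv']] := pull _ _ _ lD oV' V'0 V'D.
have [||||n [[y z] [[[_ Uy] [_ Vz]]]]] := component_transitive cff compW
    (open_setX oA oB) (open_setX oA' oB').
- by exists (u, v).
- by exists (u', v').
- by move=> [y z] [[/DW Dy _] [/Dy]].
- by move=> [y z] [[/DW Dy _] [/Dy]].
rewrite iter_ff => -[[_ U'y] [_ V'z]].
exists n; split; [exists (iter k f y)|exists (iter l f z)] => //.
  by rewrite -iterD addnC iterD.
by rewrite -iterD addnC iterD.
Qed.

End finite_extensions.

(** * Genericity and distances in compact metric spaces *)

(** The Baire category theorem, localised in [U]. *)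
Lemma compact_nested_points (X : uniformType) (U : set X) (G : nat -> set X) :
  compact [set: X] -> open U -> U !=set0 -> (forall k, open (G k)) ->
  (forall k V, open V -> V !=set0 -> V `<=` U -> V `&` G k !=set0) ->
  exists2 u, U u & forall k, G k u.
Proof.
move=> cX oU U0 oG UG.
pose good V := [/\ open V, V !=set0 & V `<=` U].
have /choice[nx nxP] (kV : nat * set X) : exists V, good kV.2 ->
    good V /\ closure V `<=` kV.2 `&` G kV.1.
  case: kV => k V /=; have [[oV V0 VU]|nV] := pselect (good V); last by exists V.
  have [A [oA A0 AV]] := open_regular (openI oV (oG k)) (UG k V oV V0 VU).
  exists A => _; split=> //; split=> // x Ax.
  by apply: VU; have [] := AV _ (subset_closure Ax).
pose V := fix V k := if k is k'.+1 then nx (k', V k') else U.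
have gV k : good (V k) by elim: k => [|k IH]; [split|have [] := nxP (k, V k) IH].
have clV k : closure (V k.+1) `<=` V k `&` G k by have [_] := nxP (k, V k) (gV k).
have VV k l : (k <= l)%N -> V l `<=` V k.
  move=> /subnKC <-; elim: (l - k)%N => [|m IH]; first by rewrite addn0.
  by rewrite addnS => x Vx; apply: IH; have [] := clV _ _ (subset_closure Vx).
have /choice[a aV] k : exists x, V k x by have [_ [x Vx] _] := gV k; exists x.
have [z clz] := compact_seq_cluster a cX.
have zV k : closure (V k.+1) z.
  move=> B; rewrite nbhsE => -[C [oC Cz] CB].
  have [m km Cam] := clz C oC Cz k.+1.
  by exists (a m); split; [exact: VV km _ (aV m)|exact: CB].
exists z; first by have [] := clV _ _ (zV 0%N).
by move=> k; have [] := clV _ _ (zV k).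
Qed.

Section metric_lemmas.
Context {R : realType} {X : metricType R}.

Lemma open_mdist_lt (c : X) (e : R) : open [set x | mdist c x < e].
Proof.
rewrite openE => x /= cx; apply/nbhs_ballP; exists (e - mdist c x) => /=.
  by rewrite subr_gt0.
move=> y; rewrite ballEmdist /= => xy.
by apply: le_lt_trans (metric_triangle c x y) _; rewrite -ltrBrDl.
Qed.

Lemma open_mdist_gt (c : X) (e : R) : open [set x | e < mdist c x].
Proof.
rewrite openE => x /= cx; apply/nbhs_ballP; exists (mdist c x - e) => /=.
  by rewrite subr_gt0.
move=> y; rewrite ballEmdist /= => xy.
have := metric_triangle c y x; rewrite (metric_sym y x) => tri.
by rewrite -(ltrD2r (mdist x y)); apply: lt_le_trans tri; rewrite -ltrBrDl.
Qed.

Lemma compact_disjoint_dist (A B : set X) : compact [set: X] -> closed A ->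
  closed B -> A `&` B = set0 ->
  exists2 e : R, 0 < e & forall a b, A a -> B b -> e <= mdist a b.
Proof.
move=> cX cA cB AB; apply: contrapT => noe.
have /choice[ab abP] k : exists ab : X * X,
    [/\ A ab.1, B ab.2 & mdist ab.1 ab.2 < k.+1%:R^-1].
  apply: contrapT => no; apply: noe; exists k.+1%:R^-1; first by rewrite invr_gt0.
  move=> a b Aa Bb; rewrite leNgt; apply/negP => lt.
  by apply: no; exists (a, b).
have [z clz] := compact_seq_cluster (fun k => (ab k).1) cX.
have Az : A z.
  apply: contrapT => nAz; have [k _] := clz _ (closed_openC cA) nAz 0%N.
  by apply; have [] := abP k.
have nBz : (~` B) z by move=> Bz; have : (A `&` B) z by []; rewrite AB.
have /nbhs_ballP[e /= e0 eB] := open_nbhs_nbhs (conj (closed_openC cB) nBz).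
have e20 : 0 < e / 2 by rewrite divr_gt0.
have [k _ ke] := near_infty_natSinv_lt (PosNum e20).
have z0 : mdist z z < e / 2 by rewrite mdistxx.
have [m km zm] := clz _ (@open_mdist_lt z (e / 2)) z0 k.
have [_ Bm abm] := abP m; apply: (eB (ab m).2) => //.
rewrite ballEmdist /=; apply: le_lt_trans (metric_triangle _ (ab m).1 _) _.
by rewrite (splitr e) ltrD // (lt_trans abm) // ke.
Qed.

End metric_lemmas.

(** * Li-Yorke sensitivity from weak mixing pieces *)

Section li_yorke.
Context {R : realType} {X : metricType R} (f : X -> X).

Lemma li_yorke_epsI (e e' : R) x y : e < e' ->
  (forall k, exists2 n, (k <= n)%N &
    mdist (iter n f x) (iter n f y) < k.+1%:R^-1) ->
  (forall k, exists2 n, (k <= n)%N & e' < mdist (iter n f x) (iter n f y)) ->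
  li_yorke_eps f e x y.
Proof.
move=> ee' close far; rewrite /li_yorke_eps.
set u := fun k => _; split.
  rewrite limn_einf_lim (_ : einfs u = cst 0%E); first by rewrite lim_cst.
  apply/funext => k /=; apply/eqP; rewrite eq_le; apply/andP; split.
    apply/lee_addgt0Pr => r r0; rewrite add0e.
    have [l _ lr] := near_infty_natSinv_lt (PosNum r0).
    have [n nkl nd] := close (maxn k l).
    apply: (@le_trans _ _ (u n)).
      by apply: ereal_inf_lbound; exists n => //=; exact: leq_trans (leq_maxl _ _) nkl.
    rewrite lee_fin ltW // (lt_trans nd) //.
    by apply: lr => /=; exact: leq_maxr.
  by apply: le_ereal_inf_tmp => _ [n _ <-]; rewrite lee_fin mdist_ge0.
rewrite limn_esup_lim; apply: (@lt_le_trans _ _ e'%:E); first by rewrite lte_fin.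
apply: lime_ge; first exact: is_cvg_esups.
apply: nearW => k; have [n kn en] := far k.
by apply: le_ereal_sup_tmp; exists (u n); [exists n|rewrite lee_fin ltW].
Qed.

Variable d : nat.
Hypotheses (cX : compact [set: X]) (cf : continuous f) (mf : minimal_map f).
Hypotheses (d0 : (0 < d)%N).

Let hX : hausdorff_space X := @metric_hausdorff R X.

(** Furstenberg's intersection lemma: hitting times from [E] to [F] serve for
    all the pairs at once. *)
Lemma weak_mixing_on_common D U (V : nat -> set X) K : weak_mixing_on f D ->
  open U -> U !=set0 -> U `<=` D ->
  (forall k, [/\ open (V k), V k !=set0 & V k `<=` D]) ->
  exists n, forall k, (k < K)%N -> exists2 u, U u & V k (iter n f u).
Proof.
move=> wD oU U0 UD VD.
suff [E [F [[oE E0 ED] [oF F0 FD] EF]]] : exists E F,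
    [/\ [/\ open E, E !=set0 & E `<=` D], [/\ open F, F !=set0 & F `<=` D] &
      forall n, (exists2 u, E u & F (iter n f u)) ->
        forall k, (k < K)%N -> exists2 u, U u & V k (iter n f u)].
  have [n [EFn _]] := wD E F E F oE oF oE oF E0 F0 E0 F0 ED FD ED FD.
  by exists n; exact: EF.
elim: K => [|K [E [F [[oE E0 ED] [oF F0 FD] EF]]]]; first by exists U, U.
have [oV V0 VKD] := VD K.
have [m [[e Ee Um] [u Fu Vm]]] :=
  wD E U F (V K) oE oU oF oV E0 U0 F0 V0 ED UD FD VKD.
have om A : open A -> open (iter m f @^-1` A).
  by apply: open_preimage; exact: continuous_iter.
exists (E `&` iter m f @^-1` U), (F `&` iter m f @^-1` V K); split.
- by split; [apply: openI => //; exact: om|exists e|move=> w [/ED]].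
- by split; [apply: openI => //; exact: om|exists u|move=> w [/FD]].
move=> n [w [Ew Uw] [Fw Vw]] k; rewrite ltnS leq_eqVlt => /predU1P[->|kK].
  by exists (iter m f w) => //; rewrite -iterD addnC iterD.
by apply: EF kK; exists w.
Qed.

(** From any point of [D] one enters [V] within [K] steps of [f^d], while weak
    mixing gives a time [n] such that [U] enters [V] at the [K + 1] times
    [(m + k) * d + n] with [k <= K]. One of these times works for [x] as well. *)
Lemma weak_mixing_on_meet x U V m :
  let D := orbit_closure (iter d f) x in weak_mixing_on f D ->
  open U -> U !=set0 -> U `<=` D -> open V -> V !=set0 -> V `<=` D ->
  exists n, [/\ (m <= n)%N, V (iter n f x) & exists2 u, U u & V (iter n f u)].
Proof.
move=> D wD oU U0 UD oV V0 VD.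
have cdf : continuous (iter d f) by exact: continuous_iter.
have Dtr z : D z -> orbit_closure (iter d f) z = D.
  by move=> Dz; exact: power_orbit_closure_eq.
have [cD fD] : closed_invariant (iter d f) D by exact: orbit_closure_invariant.
have [|K KV] := bounded_hitting cX cdf cD oV.
  move=> z Dz; have [v Vv] := V0.
  have : orbit_closure (iter d f) z v by rewrite Dtr //; exact: VD.
  move=> /(_ _ (open_nbhs_nbhs (conj oV Vv)))[_ [[k _ <-] Vk]].
  by exists k.
have fDj j z : D z -> D (iter j (iter d f) z) by move=> Dz; elim: j => //= j; exact: fD.
have surj j v : D v -> exists2 w, D w & iter j (iter d f) w = v.
  move=> Dv; have : D (iter (j * d) f x).
    by rewrite iterM; apply: fDj; exact: orbit_closure_self.
  move=> /Dtr; rewrite -(power_orbit_closure_iter _ cX hX cf) => jD.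
  have [w Dw wv] : (iter (j * d) f @` D) v by rewrite jD.
  by exists w; rewrite // -iterM.
have [|n nV] := @weak_mixing_on_common D U
    (fun k => D `&` iter (m + k) (iter d f) @^-1` V) K.+1 wD oU U0 UD.
  move=> k; split; last by move=> w [].
    apply: openI; first exact: power_orbit_closure_open.
    by apply: open_preimage => //; exact: continuous_iter.
  have [v Vv] := V0; have [w Dw wv] := surj (m + k)%N v (VD _ Vv).
  by exists w; split=> //=; rewrite wv.
(* At time [n] the point [x] is in its piece since some point of [D] is sent there. *)
have Dn : D (iter n f x).
  have [u Uu [Du _]] := nV 0%N isT.
  have : (iter n f @` D) (iter n f u) by exists u => //; exact: UD.
  rewrite power_orbit_closure_iter // => Dnu.
  have E1 := power_orbit_closure_eq cX hX cf mf d0 Dnu.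
  by have E2 := Dtr _ Du; rewrite -E2 E1; exact: orbit_closure_self.
have [k kK Vk] := KV _ (fDj m _ Dn).
have [u Uu [_ Vu]] := nV k kK.
have sum z : iter (m + k) (iter d f) (iter n f z) = iter ((m + k) * d + n) f z.
  by rewrite -iterM -iterD.
exists ((m + k) * d + n)%N; split.
- apply: leq_trans (leq_addr _ _).
  by apply: leq_trans (leq_addr k m) _; exact: leq_pmulr.
- by rewrite -sum addnC iterD.
- by exists u => //; rewrite -sum.
Qed.

(** In the piece of [x], the points that are proximal to [x] and those that
    separate from [x] again and again both form a residual set. *)
Lemma LYS_of_power_weak_mixing (e : R) : 0 < e ->
  (forall x, weak_mixing_on f (orbit_closure (iter d f) x)) ->
  (forall x U k, open U -> U !=set0 -> exists n u,
    [/\ (k <= n)%N, U u & e < mdist (iter n f x) (iter n f u)]) ->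
  LYS f.
Proof.
move=> e0 wD sens; exists (e / 2); first by rewrite divr_gt0.
move=> x A; rewrite nbhsE => -[B [oB Bx] BA].
pose D := orbit_closure (iter d f) x.
have oD : open D by exact: power_orbit_closure_open.
have Dx : D x by exact: orbit_closure_self.
pose G1 k := \bigcup_(n in [set n | (k <= n)%N])
  (iter n f @^-1` [set y | mdist (iter n f x) y < k.+1%:R^-1]).
pose G2 k := \bigcup_(n in [set n | (k <= n)%N])
  (iter n f @^-1` [set y | e < mdist (iter n f x) y]).
have oG1 k : open (G1 k).
  apply: bigcup_open => n _; apply: open_preimage; last exact: open_mdist_lt.
  exact: continuous_iter.
have oG2 k : open (G2 k).
  apply: bigcup_open => n _; apply: open_preimage; last exact: open_mdist_gt.
  exact: continuous_iter.
have mG1 k V : open V -> V !=set0 -> V `<=` D -> V `&` G1 k !=set0.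
  move=> oV V0 VD; have r0 : 0 < k.+1%:R^-1 / 2 :> R by rewrite divr_gt0 ?invr_gt0.
  pose C := D `&` [set y | mdist x y < k.+1%:R^-1 / 2].
  have oC : open C by apply: openI => //; exact: open_mdist_lt.
  have C0 : C !=set0 by exists x; split=> //=; rewrite mdistxx.
  have CD : C `<=` D by move=> y [].
  have [n [kn [_ /= xn] [u Vu [_ /= un]]]] :=
    weak_mixing_on_meet k (wD x) oV V0 VD oC C0 CD.
  exists u; split=> //; exists n => //=.
  apply: le_lt_trans (metric_triangle _ x _) _.
  by rewrite (metric_sym _ x) (splitr k.+1%:R^-1) ltrD.
have mG2 k V : open V -> V !=set0 -> V `&` G2 k !=set0.
  by move=> oV V0; have [n [u [kn Vu eu]]] := sens x V k oV V0;
    exists u; split=> //; exists n.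
have [|k||y [By Dy] yG] := @compact_nested_points X (B `&` D)
    (fun k => G1 k `&` G2 k) cX (openI oB oD).
- by exists x.
- exact: openI.
- move=> k V oV V0 VBD; rewrite setIA; apply: mG2; first exact: openI.
  by apply: mG1 => // z /VBD[].
exists y; split; last exact: BA.
apply: (@li_yorke_epsI _ e).
- by rewrite ltr_pdivrMr // mulr_natr mulr2n ltrDl.
- by move=> k; have [[n kn xn] _] := yG k; exists n.
- by move=> k; have [_ [n kn xn]] := yG k; exists n.
Qed.

End li_yorke.

(** A weak mixing system spreads every open set over two separated regions of
    [Y] at arbitrarily late times, and a semi-open [p] brings this to [X]. *)
Lemma semi_open_extension_sensitive (R : realType) (X Y : metricType R)
    (f : X -> X) (S : Y -> Y) (p : X -> Y) :
  compact [set: X] -> continuous S -> range S = [set: Y] -> weak_mixing S ->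
  continuous p -> semi_open p -> range p = [set: Y] ->
  (forall x, p (f x) = S (p x)) ->
  (exists y0 y1 : Y, y0 <> y1) ->
  exists2 e : R, 0 < e & forall x U k, open U -> U !=set0 -> exists n u,
    [/\ (k <= n)%N, U u & e < mdist (iter n f x) (iter n f u)].
Proof.
move=> cX cS rS wS cp sp rp pf [y0 [y1 y01]].
have [V1 [oV1 V10 V1y]] : exists V, [/\ open V, V !=set0 & closure V `<=` ~` [set y1]].
  apply: open_regular; last by exists y0 => /= y0E; exact: y01.
  apply: closed_openC; apply: compact_closed; first exact: metric_hausdorff.
  exact: compact_set1.
have [V2 [oV2 V20 V2V1]] : exists V, [/\ open V, V !=set0 & closure V `<=` ~` closure V1].
  apply: open_regular; last by exists y1 => /V1y; apply.
  by apply: closed_openC; exact: closed_closure.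
have [|||e e0 eP] := @compact_disjoint_dist _ X
    (p @^-1` closure V1) (p @^-1` closure V2) cX.
- by apply: closed_preimage => //; exact: closed_closure.
- by apply: closed_preimage => //; exact: closed_closure.
- by rewrite -subset0 => x [/= V1x /V2V1].
have e30 : 0 < e / 3 by rewrite divr_gt0.
exists (e / 3) => // x U k oU U0.
have [G [oG G0 GU]] := sp _ oU U0.
have oSk V : open V -> open (iter k S @^-1` V).
  by apply: open_preimage; exact: continuous_iter.
have Sk0 V : V !=set0 -> iter k S @^-1` V !=set0.
  move=> [v Vv]; have [w _ wv] : range (iter k S) v by rewrite range_iter.
  by exists w; rewrite /= wv.
have itp n z : p (iter n f z) = iter n S (p z) by elim: n => //= n <-.
have [||||n [_ [q [[/= Gq1 Gq2] [V1q V2q]]]]] :=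
    wS (G `*` G) ((iter k S @^-1` V1) `*` (iter k S @^-1` V2)).
- exact: open_setX.
- by apply: open_setX; exact: oSk.
- by have [g Gg] := G0; exists (g, g).
- by have [v V1v] := Sk0 _ V10; have [w V2w] := Sk0 _ V20; exists (v, w).
move: V1q V2q.
have -> : iter n (fun r : Y * Y => (S r.1, S r.2)) q = (iter n S q.1, iter n S q.2).
  by elim: (n) => [|m /= ->]; case: (q).
rewrite /= -!iterD => V1q V2q.
have [u1 Uu1 pu1] := GU _ Gq1; have [u2 Uu2 pu2] := GU _ Gq2.
(* One of the two orbits is at distance at least [e / 2] from that of [x]. *)
have dist12 : e <= mdist (iter (k + n) f u1) (iter (k + n) f u2).
  by apply: eP; apply: subset_closure; rewrite /= itp ?pu1 ?pu2.
have [far1|near1] := ltP (e / 3) (mdist (iter (k + n) f x) (iter (k + n) f u1)).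
  by exists (k + n)%N, u1; split=> //; exact: leq_addr.
exists (k + n)%N, u2; split=> //; first exact: leq_addr.
have := metric_triangle (iter (k + n) f u1) (iter (k + n) f x) (iter (k + n) f u2).
rewrite (metric_sym _ (iter (k + n) f x)) => tri.
lra.
Qed.

Lemma LYS_of_minimal_finite_extension (R : realType) (X Y : metricType R)
    (f : X -> X) (S : Y -> Y) (p : X -> Y) (N : nat) :
  compact [set: X] -> continuous f -> minimal_map f ->
  compact [set: Y] -> continuous S -> minimal_map S -> weak_mixing S ->
  continuous p -> (forall x, p (f x) = S (p x)) -> fibres_le p N ->
  (exists y0 y1 : Y, y0 <> y1) -> LYS f.
Proof.
move=> cX cf mf cY cS mS wS cp pf pN Y2.
have [X0|/nonemptyPn X0] := pselect ([set: X] !=set0); last first.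
  by exists 1 => // x; have : [set: X] x by []; rewrite X0.
have [d d0 wD] := power_weak_mixing cX cf mf cY cS mS wS cp pf pN X0.
have rS := minimal_surjective cY cS mS (@metric_hausdorff _ _).
have rp := minimal_factor_range cX mS cp pf X0.
have sp := factor_semi_open cX cf mf cY cS mS cp pf X0.
have [e e0 sens] := semi_open_extension_sensitive cX cS rS wS cp sp rp pf Y2.
exact: LYS_of_power_weak_mixing wD sens.
Qed.

(** * Passing to a minimal subset *)

Section subtypes.
Context {X : topologicalType} (M : set X).

Lemma compact_set_type : compact M -> compact [set: M].
Proof.
move=> cM F FF _.
have FM : (val @ F) M.
  apply: (@filterS _ F _ setT); last exact: filterT.
  by move=> m _ /=; case: m => x /= /set_mem.
have [x [Mx clx]] := cM _ _ FM.
pose m : M := exist _ x (mem_set Mx).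
exists m; split=> // A B FA; rewrite nbhsE => -[C [[C' oC' <-] /= C'x] CB].
have FA' : (val @ F) (val @` A).
  by apply: (@filterS _ F _ A) FA => a Aa; exists a.
have [_ [[a Aa <-] C'a]] := clx _ _ FA' (open_nbhs_nbhs (conj oC' C'x)).
by exists a; split=> //; exact: CB.
Qed.

Lemma continuous_restrict_map (T : X -> X) (TM : set_fun M M T) :
  continuous T -> continuous (restrict_map TM).
Proof.
move=> cT; apply: (@continuous_comp_initial M M X val).
have -> : val \o restrict_map TM = T \o val by [].
by move=> m; apply: continuous_comp; [exact: initial_continuous|exact: cT].
Qed.

End subtypes.

Lemma fibres_le_card (X : choiceType) (Y : Type) (p : X -> Y) (M : set X) n :
  (forall y, (p @^-1` [set y] #= `I_n)%card) -> fibres_le (p \o (val : M -> X)) n.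
Proof.
move=> fib y s us sy; have /card_set_bijP[g [gI ginj _]] := fib y.
rewrite -(size_map (g \o val)) -(size_iota 0 n); apply: uniq_leq_size.
  rewrite map_inj_in_uniq // => a b /sy pa /sy pb ab.
  by apply: val_inj; apply: ginj ab; apply/mem_set.
by move=> _ /mapP[a /sy pa ->]; rewrite mem_iota add0n; exact: gI.
Qed.

Theorem theorem18 (R : realType) (Y : metricType R) (S : Y -> Y)
    (hS : tds S) (minS : minimal_map S) (wmS : weak_mixing S)
    (ncY : ~ connected [set: Y])
    (uniY : forall K : set Y, continuum K -> unicoherent K)
    (n : nat) (n_gt0 : (0 < n)%N)
    (X : metricType R) (T : X -> X) (hT : tds T)
    (p : X -> Y) (hp : factor_map T S p)
    (fib : forall y : Y, (p @^-1` [set y] #= `I_n)%card)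
    (M : set X) (hM : minimal_set T M) :
  LYS (restrict_map (minimal_set_fun hM)).
Proof.
have [cY cS _] := hS; have [cX cT _] := hT; have [cp _ pT] := hp.
have [_ clM TM mM] := hM.
have [y0 [y1 y01]] : exists y0 y1 : Y, y0 <> y1.
  apply: contrapT => no; apply: ncY => B [y By] _ _; apply/seteqP; split=> // z _.
  suff -> : z = y by [].
  by apply: contrapT => zy; apply: no; exists z, y.
apply: (@LYS_of_minimal_finite_extension R M Y _ S (p \o val) n) => //.
- by apply: compact_set_type; exact: subclosed_compact cX _.
- exact: continuous_restrict_map.
- exact: minimal_set_minimal.
- by move=> m; apply: continuous_comp; [exact: initial_continuous|exact: cp].
- by move=> m /=; rewrite -[S _]/((S \o p) (val m)) -pT.
- exact: fibres_le_card.
- by exists y0, y1.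
Qed.
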